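(* Let $P_n$ and $\mu_n$, $n\in\mathbb N$, be sequences of probability measures on some measurable space $(\Omega,\mathcal A)$, where the $P_n$ are random and the $\mu_n$ are deterministic. Let $\mathcal F$ be a class of measurable real-valued functions defined on $(\Omega,\mathcal A)$. Assume that there exist a real-valued sequence $r_n\uparrow\infty$, a tight random process $G\in\ell^\infty(\mathcal F)$ and a probability measure $\mu$ such that $r_n(P_n-\mu_n)\rightsquigarrow G$ and $\mu_n\to\mu$ in $\ell^\infty(\mathcal F)$. Assume that almost all sample paths of $G$ are uniformly continuous with respect to the supremum norm (on $\mathcal F$). Then for any $m\in\mathbb N$, $$r_n(P_n^m-\mu_n^m)\rightsquigarrow G_\mu^{(m)}\quad\text{in }\ell^\infty(\mathcal F_m),$$ where $\mathcal F_m$ and $G_\mu^{(m)}$ are as defined in the context. The transformation $G\mapsto G_\mu^{(m)}$ is linear and continuous for all $m\in\mathbb N$; therefore, if $G$ is Borel measurable and/or tight and/or Gaussian and/or centred, then so is $G_\mu^{(m)}$. If $G$ has covariance function $\Gamma$, then $G_\mu^{(m)}$ has covariance function $$\Gamma_\mu^{(m)}(h,h')=\sum_{i,j=1}^m\Gamma(h_{\mu,i},h'_{\mu,j}),$$ where $h_{\mu,i}$ and $h'_{\mu,j}$ are constructed from $h,h'\in\mathcal F_m$ as in the context.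
   Context: Measures act on functions by integration, $\nu(f)=\int f\,d\nu$; $\nu^m$ is the $m$-fold product measure. The class $\mathcal F_m$: $\mathcal F_1=\mathcal F$, and for $m\ge2$, $\mathcal F_m$ consists of all bounded measurable functions $h:(\Omega^m,\mathcal A^m)\to\mathbb R$ such that for any product probability measure $Q=Q_1\otimes\cdots\otimes Q_{m-1}$ on $(\Omega^{m-1},\mathcal A^{m-1})$ and any $i=1,\dots,m$, the function $x\mapsto\int h(x_1,\dots,x_{i-1},x,x_{i+1},\dots,x_m)\,dQ(x_1,\dots,x_{i-1},x_{i+1},\dots,x_m)$ is an element of $\mathcal F$. The process $G_\mu^{(m)}\in\ell^\infty(\mathcal F_m)$: for $G\in\ell^\infty(\mathcal F)$ and a probability measure $\mu$ on $(\Omega,\mathcal A)$, $G_\mu^{(1)}=G$, and for $m\ge2$, $G_\mu^{(m)}(h)=\sum_{i=1}^mG(h_{\mu,i})$ with $h_{\mu,i}(x)=\int h(x_1,\dots,x_{i-1},x,x_{i+1},\dots,x_m)\,d\mu^{m-1}(x_1,\dots,x_{i-1},x_{i+1},\dots,x_m)$ (for $m=1$, $h_{\mu,1}=h$). $\ell^\infty(T)$ is the space of bounded real functions on $T$ with the supremum norm. Weak convergence $\rightsquigarrow$ is in the Hoffmann-Jørgensen sense: the limit is Borel measurable and $\mathbb E^*f(X_n)\to\mathbb Ef(X)$ for all bounded continuous $f:\ell^\infty(T)\to\mathbb R$, with $\mathbb E^*$ the outer expectation. *)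

(* Defs.v *)
From HB Require Import structures.
From mathcomp Require Import all_boot all_order all_algebra.
From mathcomp Require Import all_classical all_reals all_analysis.
From mathcomp Require Import measurable_realfun.

Set Implicit Arguments.
Unset Strict Implicit.
Unset Printing Implicit Defensive.

Import Order.TTheory GRing.Theory Num.Theory.
Import numFieldNormedType.Exports.

Local Open Scope classical_set_scope.
Local Open Scope ring_scope.

Section linf.
Context (R : realType) (T : Type).

(* [bounded_fun] needs a normed codomain, hence [R^o] (convertible to [R]). *)
Definition bounded_pred : {pred T -> R^o} := mem (bounded_fun : set (T -> R^o)).

Definition in_linf (f : T -> R) : Prop := bounded_fun (f : T -> R^o).

Lemma bounded_predP (f : T -> R^o) :
  reflect (exists M : R, forall t, `|f t| <= M) (f \in bounded_pred).
Proof.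
apply: (iffP idP) => [|[M fM]].
  rewrite inE => -[M [_ fM]]; exists (M + 1) => t.
  by apply: (fM (M + 1)) => //; rewrite ltrDl.
rewrite inE; exists M; split; first exact: num_real.
by move=> x Mx t _; exact: le_trans (fM t) (ltW Mx).
Qed.

Lemma bounded_pred_submod_closed : submod_closed bounded_pred.
Proof.
split=> [|a u v /bounded_predP[M uM] /bounded_predP[N vN]]; apply/bounded_predP.
  by exists 0 => t; rewrite normr0.
exists (`|a| * M + N) => t.
rewrite (le_trans (ler_normD _ _))// lerD// normrM ler_wpM2l//.
Qed.

HB.instance Definition _ :=
  GRing.isSubmodClosed.Build R (T -> R^o) bounded_pred
    bounded_pred_submod_closed.

(* l^oo(T); [T] is an arbitrary type, in practice the carrier of a set of
   functions. The topology below is that of the supremum norm. *)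
Record linf := Linf_subproof {
  linf_fun :> T -> R^o ;
  _ : linf_fun \in bounded_pred }.

HB.instance Definition _ := [isSub of linf for linf_fun].
HB.instance Definition _ := [Choice of linf by <:].
HB.instance Definition _ := [SubChoice_isSubLmodule of linf by <:].

Definition Linf (f : T -> R) (bf : in_linf f) : linf :=
  @Linf_subproof f (mem_set bf).

Definition linf_norm (f : linf) : R := sup (range (fun t => `|f t|)).

Lemma linf_norm_ub (f : linf) t : `|f t| <= linf_norm f.
Proof.
apply: ub_le_sup; last by exists t.
have /bounded_predP[M fM] : linf_fun f \in bounded_pred by case: f.
by exists M => _ [s _ <-].
Qed.

Lemma linf_norm_le (f : linf) (M : R) :
  0 <= M -> (forall t, `|f t| <= M) -> linf_norm f <= M.
Proof.
move=> M0 fM; rewrite /linf_norm; set S := (X in sup X).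
have [->|/set0P ne] := eqVneq S set0; first by rewrite sup0.
by apply: ge_sup => // _ [t _ <-].
Qed.

Lemma linf_norm_ge0 (f : linf) : 0 <= linf_norm f.
Proof.
rewrite {1}/linf_norm; set S := (X in sup X).
have [->|/set0P[_ [t _ _]]] := eqVneq S set0; first by rewrite sup0.
by rewrite -[sup S]/(linf_norm f) (le_trans _ (linf_norm_ub f t)).
Qed.

Lemma linfP (f g : linf) : (forall t, f t = g t) -> f = g.
Proof. by move=> fg; apply/val_inj/funext. Qed.

Lemma linf_normD (f g : linf) : linf_norm (f + g) <= linf_norm f + linf_norm g.
Proof.
apply: linf_norm_le => [|t]; first by rewrite addr_ge0 ?linf_norm_ge0.
by rewrite (le_trans (ler_normD _ _))// lerD ?linf_norm_ub.
Qed.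

Lemma linf_normZ (a : R) (f : linf) : linf_norm (a *: f) = `|a| * linf_norm f.
Proof.
have le b g : linf_norm (b *: g) <= `|b| * linf_norm g.
  apply: linf_norm_le => [|t]; first by rewrite mulr_ge0 ?linf_norm_ge0.
  by rewrite normrM ler_wpM2l ?linf_norm_ub.
apply/eqP; rewrite eq_le le/=; have [->|a0] := eqVneq a 0.
  by rewrite normr0 mul0r linf_norm_ge0.
rewrite -ler_pdivlMl ?normr_gt0// -normfV.
by rewrite -{1}[f](scale1r) -(mulVf a0) -scalerA le.
Qed.

Lemma linf_norm0_eq0 (f : linf) : linf_norm f = 0 -> f = 0.
Proof.
move=> f0; apply: linfP => t; apply/eqP.
by rewrite -normr_le0 -f0 linf_norm_ub.
Qed.

HB.instance Definition _ := @Lmodule_isNormed.Build R linf linf_norm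
  linf_normD linf_normZ linf_norm0_eq0.

End linf.

Section prodm.
Context d (X : measurableType d) (R : realType).

Section cons.
Variable n : nat.

Definition cons_tuple2 (xy : X * n.-tuple X) : n.+1.-tuple X :=
  [the n.+1.-tuple X of xy.1 :: xy.2].

Lemma measurable_cons_tuple2 : measurable_fun [set: X * n.-tuple X] cons_tuple2.
Proof. exact: (measurable_cons measurable_fst measurable_snd). Qed.

HB.instance Definition _ :=
  isMeasurableFun.Build _ _ _ _ cons_tuple2 measurable_cons_tuple2.

End cons.

(* The product measure Q_1 (x) ... (x) Q_n, carried from X * X^(n-1) to X^n;
   [n.-tuple X] bears the product sigma-algebra. *)
Fixpoint prodm n : ('I_n -> probability X R) -> probability (n.-tuple X) R :=
  match n return ('I_n -> probability X R) -> probability (n.-tuple X) R with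
  | 0 => fun _ => \d_([tuple] : 0.-tuple X)
  | k.+1 => fun Q =>
      distribution (Q ord0 \x prodm (fun i => Q (lift ord0 i)))%E
        (@cons_tuple2 k)
  end.

Definition powm (nu : probability X R) n : probability (n.-tuple X) R :=
  prodm (fun _ : 'I_n => nu).

Lemma prodm_box n (Q : 'I_n -> probability X R) (A : 'I_n -> set X) :
    (forall i, measurable (A i)) ->
  prodm Q [set t | forall i, A i (tnth t i)] = (\prod_(i < n) Q i (A i))%E.
Proof.
elim: n Q A => [|n IH] Q A mA.
  by rewrite big_ord0 /= diracE mem_set// => -[].
rewrite big_ord_recl -(IH (fun i => Q (lift ord0 i)) (A \o lift ord0)); last first.
  by move=> i; exact: mA.
rewrite -product_measure1E//; last first.
  rewrite (_ : mkset _ =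
      \bigcap_(i in [set: 'I_n]) [set t | A (lift ord0 i) (tnth t i)]).
    apply: fin_bigcap_measurable => // i _.
    by rewrite -[X in measurable X]setTI; exact: measurable_tnth.
  by apply/seteqP; split => t /= h i; [move=> _; exact: h|exact: h].
rewrite /= /distribution /pushforward; congr (product_measure1 _ _ _).
apply/seteqP; split => [[x t] h|[x t] [h0 h]].
  split; first by have := h ord0.
  by move=> i /=; have := h (lift ord0 i); rewrite tnthS.
by move=> i; case: (unliftP ord0 i) => [j|] ->; [rewrite tnthS; exact: h|].
Qed.

End prodm.

Section function_classes.
Context d (X : measurableType d) (R : realType).

Definition integral_on (F : set (X -> R)) (nu : probability X R) (f : F) : R :=
  \int[nu]_x val f x.

Definition scaled_diff (F : set (X -> R)) (c : R) (nu nu' : probability X R)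
  (f : F) : R := c * (integral_on nu f - integral_on nu' f).

(* (x_1, .., x_(i-1), x, x_(i+1), .., x_m) from x and the other m - 1
   coordinates y, where m = k + 1. *)
Definition insert_coord k (i : 'I_k.+1) (x : X) (y : k.-tuple X) :
    k.+1.-tuple X :=
  [tuple if unlift i j is Some l then tnth y l else x | j < k.+1].

Definition partial_int k (Q : probability (k.-tuple X) R)
    (h : k.+1.-tuple X -> R) (i : 'I_k.+1) (x : X) : R :=
  \int[Q]_y h (insert_coord i x y).

(* The class F_m and the functions h_(mu, i), for m = k + 1 >= 1. Functions on
   X and on X^1 = 1.-tuple X are identified through x |-> [tuple x]. *)
Definition Fm (F : set (X -> R)) k : set (k.+1.-tuple X -> R) :=
  match k return set (k.+1.-tuple X -> R) with
  | 0 => [set h | F (fun x => h [tuple x])]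
  | k'.+1 => [set h | [/\ measurable_fun [set: k'.+2.-tuple X] h,
      in_linf h &
      forall (Q : 'I_k'.+1 -> probability X R) (i : 'I_k'.+2),
        F (partial_int (prodm Q) h i)]]
  end.

Arguments Fm F k : clear implicits.

Definition hmu (mu : probability X R) k :
    (k.+1.-tuple X -> R) -> 'I_k.+1 -> X -> R :=
  match k return (k.+1.-tuple X -> R) -> 'I_k.+1 -> X -> R with
  | 0 => fun h _ x => h [tuple x]
  | k'.+1 => partial_int (powm mu k'.+1)
  end.

Lemma hmu_in (mu : probability X R) (F : set (X -> R)) k (h : Fm F k)
  (i : 'I_k.+1) : F (hmu mu (val h) i).
Proof.
case: h => /= h /set_mem; case: k h i => [//|k] h i [_ _ Fh].
exact: (Fh (fun=> mu) i).
Qed.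

Definition hmuF (mu : probability X R) (F : set (X -> R)) k (h : Fm F k)
  (i : 'I_k.+1) : F := SigSub (mem_set (hmu_in mu h i)).

Lemma G_mu_bounded (mu : probability X R) (F : set (X -> R)) k (G : linf R F) :
  in_linf (fun h : Fm F k => \sum_(i < k.+1) G (hmuF mu h i) : R).
Proof.
apply/set_mem/bounded_predP; exists (\sum_(i < k.+1) linf_norm G) => h.
by rewrite (le_trans (ler_norm_sum _ _ _))// ler_sum// => i _; exact: linf_norm_ub.
Qed.

Definition G_mu (mu : probability X R) (F : set (X -> R)) k (G : linf R F) :
  linf R (Fm F k) := Linf (G_mu_bounded mu k G).

Definition Gamma_mu (mu : probability X R) (F : set (X -> R)) k
    (Gamma : F -> F -> R) (h h' : Fm F k) : R :=
  \sum_(i < k.+1) \sum_(j < k.+1) Gamma (hmuF mu h i) (hmuF mu h' j).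

Definition sup_norm (f : X -> R) : \bar R :=
  ereal_sup (range (fun x => `|f x|%:E)).

Definition sup_unif_continuous (F : set (X -> R)) (z : F -> R) : Prop :=
  forall e : R, 0 < e -> exists2 delta : R, 0 < delta &
    forall f g : F, (sup_norm (val f \- val g)%R < delta%:E)%E ->
      `|z f - z g| < e.

End function_classes.
Arguments integral_on {d X R} F nu f.
Arguments scaled_diff {d X R} F c nu nu' f.
Arguments Fm {d X R} F k.

Section random_elements.
Context d (W : measurableType d) (R : realType) (P : probability W R).

(* E^* Z = inf {E U : U >= Z measurable and E U exists in [-oo, +oo]} *)
Definition outer_expectation (Z : W -> \bar R) : \bar R :=
  ereal_inf [set (\int[P]_w U w)%E | U in [set U : W -> \bar R |
    [/\ measurable_fun [set: W] U,
       (\int[P]_w (U^\+ w) < +oo \/ \int[P]_w (U^\- w) < +oo)%E &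
       forall w, (Z w <= U w)%E]]].

Definition borel_measurable (T : normedModType R) (Y : W -> T) : Prop :=
  measurable_fun [set: W] (Y : W -> g_sigma_algebraType (@open T)).

(* The event inside {Y \in K} makes this meaningful for maps that are not
   known to be Borel measurable; if Y is, it says P (Y \in K) >= 1 - e. *)
Definition tight (T : normedModType R) (Y : W -> T) : Prop :=
  forall e : R, 0 < e -> exists2 K : set T, compact K &
    exists A : set W, [/\ measurable A, A `<=` Y @^-1` K &
      ((1 - e)%:E <= P A)%E].

(* N(m, s^2); the library leaves the degenerate case s = 0 out. *)
Definition normal_rv (Z : W -> R) : Prop :=
  measurable_fun [set: W] Z /\
  exists m s : R, forall A : set R, measurable A ->
    P (Z @^-1` A) = if s == 0 then \d_m A else normal_prob m s A.

(* All finite-dimensional marginals are multivariate normal, i.e. all linear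
   combinations of their coordinates are normal, possibly degenerate. *)
Definition gaussian (T : Type) (Y : W -> linf R T) : Prop :=
  forall n (t : 'I_n -> T) (a : 'I_n -> R),
    normal_rv (fun w => \sum_(i < n) a i * Y w (t i)).

Definition centred (T : Type) (Y : W -> linf R T) : Prop :=
  forall t, P.-integrable [set: W] (fun w => (Y w t)%:E) /\
    ('E_P[fun w => Y w t] = 0)%E.

Definition has_covariance (T : Type) (Y : W -> linf R T) (Gamma : T -> T -> R)
    : Prop :=
  (forall t, (fun w => Y w t : R) \in Lfun P 2%:E) /\
  forall s t, covariance P (fun w => Y w s) (fun w => Y w t) = (Gamma s t)%:E.

End random_elements.

(* Hoffmann-Jorgensen weak convergence: each Y_n is an arbitrary map on its own
   probability space. *)
Definition weak_cvg (R : realType) (T : Type)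
    (dn : nat -> measure_display) (Wn : forall n, measurableType (dn n))
    (Pn : forall n, probability (Wn n) R) (Yn : forall n, Wn n -> linf R T)
    d (W : measurableType d) (P : probability W R) (Y : W -> linf R T) : Prop :=
  borel_measurable Y /\
  forall f : linf R T -> R^o, continuous f -> bounded_fun f ->
    outer_expectation (Pn n) (fun w => (f (Yn n w))%:E) @[n --> \oo] -->
    ('E_P[fun w => f (Y w)])%E.

(* Main.v *)
Require Import Defs.
From HB Require Import structures.
From mathcomp Require Import all_boot all_order all_algebra.
From mathcomp Require Import all_classical all_reals all_analysis.
From mathcomp Require Import measurable_realfun.
From mathcomp Require Import lra.

Set Implicit Arguments.
Unset Strict Implicit.
Unset Printing Implicit Defensive.

Import Order.TTheory GRing.Theory Num.Theory.
Import numFieldNormedType.Exports.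

Local Open Scope classical_set_scope.
Local Open Scope ring_scope.

(** Write X_n for r_n (P_n - mu_n), seen in l^oo(F). Replacing the factors of
    P_n^m by those of mu_n one at a time, and integrating out the other
    coordinates at each step, turns the increment at h in F_m into a sum of m
    terms X_n(g_i), where g_i is a partial integral of h, hence again in F
    ([scaled_diff_decomposition]). If every X_n(g_i) were X_n(h_(mu, i)), the
    sum would be the image of X_n under the map G |-> G_mu, which is linear
    and Lipschitz, and the continuous mapping theorem would conclude.

    The functions g_i and h_(mu, i) differ only in the laws of the integrated
    coordinates, which are P_n or mu_n for the former and mu for the latter.
    Telescoping again, with the free coordinate frozen by a Dirac mass, bounds
    their distance in supremum norm, uniformly in h, by a multiple of
    |P_n - mu| + |mu_n - mu|, norms in l^oo(F) ([partial_int_close]). As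
    |P_n - mu_n| = |X_n| / r_n, this is small as soon as |X_n| is bounded and
    n is large. Hence the error is at most m times the oscillation of X_n over
    pairs of functions of F that are uniformly close.

    This oscillation is a continuous function of X_n, and it tends to 0 along
    G because almost all paths of G are uniformly continuous. So the error is
    dominated by test functions rho_j(X_n), with rho_j continuous, between 0
    and 1, and rho_j(G) -> 0 almost surely; they are [osc_test]. That such a
    domination carries weak convergence over is [weak_cvg_approx]: a bounded
    continuous f of the perturbed process is squeezed between bounded
    continuous functions of X_n, obtained from the Lipschitz envelopes of f,
    whose expectations at G are close to that of f(G_mu) by dominated
    convergence on the probability space of G. *)

(** * Product probability measures on tuples *)

Section product_probability.
Context d (X : measurableType d) (R : realType).
Implicit Types (n : nat).

(** Boxes form a pi-system that generates the product sigma-algebra. *)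
Lemma prodm_unique n (Q : 'I_n -> probability X R)
    (m : {measure set (n.-tuple X) -> \bar R}) :
    (forall A : 'I_n -> set X, (forall i, measurable (A i)) ->
      m [set t | forall i, A i (tnth t i)] = (\prod_(i < n) Q i (A i))%E) ->
  forall B, measurable B -> m B = prodm Q B.
Proof.
move=> mQ B mB.
pose G : set (set (n.-tuple X)) :=
  [set [set t | forall i, A i (tnth t i)] | A in
    [set A : 'I_n -> set X | forall i, measurable (A i)]].
have boxT : [set t : n.-tuple X | forall i, setT (tnth t i)] = setT.
  by apply/seteqP; split.
have GT : G setT by exists (fun=> setT) => // i; exact: measurableT.
apply: (measure_unique G (fun=> setT)) => //.
- apply/seteqP; split; last first.
    apply: smallest_sub; first exact: sigma_algebra_measurable.
    move=> _ [A mA <-].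
    rewrite (_ : mkset _ =
        \bigcap_(i in [set: 'I_n]) [set t | A i (tnth t i)]).
      apply: fin_bigcap_measurable => // i _.
      by rewrite -[X in measurable X]setTI; exact: measurable_tnth.
    by apply/seteqP; split => t /= h i; [move=> _; exact: h|exact: h].
  apply: sub_smallest2r => //=; rewrite -bigcup_seq.
  move=> _ [i _ [C mC <-]].
  exists (fun j => if j == i then C else setT).
    by move=> j; case: ifP => // _; exact: measurableT.
  apply/seteqP; split => [t /(_ i)|t [_ /= Ct] j]; first by rewrite eqxx.
  by case: eqP => [->|].
- move=> _ _ [A mA <-] [B' mB' <-]; exists (fun i => A i `&` B' i).
    by move=> i; exact: measurableI.
  apply/seteqP; split => [t h|t [h1 h2] i]; last by split.
  by split => i; have [] := h i.
- by rewrite bigcup_const.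
- move=> _ [A mA <-]; by rewrite mQ//; apply/esym; exact: prodm_box.
- move=> k /=; rewrite -boxT (mQ (fun=> setT))//.
  by rewrite big1 ?ltry// => i _; exact: probability_setT.
Qed.

Definition insert_pair k (i : 'I_k.+1) (xy : X * k.-tuple X) :
  k.+1.-tuple X := insert_coord i xy.1 xy.2.

Lemma measurable_insert_pair k (i : 'I_k.+1) :
  measurable_fun [set: X * k.-tuple X] (insert_pair i).
Proof.
apply/measurable_fun_tnthP => j /=.
rewrite (_ : _ \o _ = fun xy : X * k.-tuple X =>
  if unlift i j is Some l then tnth xy.2 l else xy.1); last first.
  by apply/funext => xy /=; rewrite tnth_mktuple.
case: unliftP => [l _|_]; last exact: measurable_fst.
by apply: measurableT_comp (measurable_tnth l) measurable_snd.
Qed.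

HB.instance Definition _ k (i : 'I_k.+1) :=
  isMeasurableFun.Build _ _ _ _ (insert_pair i) (measurable_insert_pair i).

(** [prodm] is built by splitting off the first coordinate; comparing masses of
    boxes, where the order of the factors is immaterial, shows that any other
    coordinate may be split off instead. *)
Lemma prodm_insert k (Q : 'I_k.+1 -> probability X R) (i : 'I_k.+1) B :
    measurable B ->
  pushforward (Q i \x prodm (Q \o lift i))%E (insert_pair i) B = prodm Q B.
Proof.
apply: (prodm_unique
  (m := pushforward (Q i \x prodm (Q \o lift i))%E (insert_pair i))).
move=> A mA.
pose B' := [set t : k.-tuple X | forall j, A (lift i j) (tnth t j)].
have mB' : measurable B'.
  rewrite (_ : B' = \bigcap_(j in [set: 'I_k])
      [set t | A (lift i j) (tnth t j)]).
    apply: fin_bigcap_measurable => // j _.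
    by rewrite -[X in measurable X]setTI; exact: measurable_tnth.
  by apply/seteqP; split => t /= h j; [move=> _; exact: h|exact: h].
transitivity (Q i (A i) * prodm (Q \o lift i) B')%E; last first.
  rewrite (bigD1_ord i)//=; congr (_ * _)%E.
  exact: (prodm_box (Q \o lift i) (fun j => mA (lift i j))).
rewrite -product_measure1E//.
congr (product_measure1 _ _ _).
apply/seteqP; split => [[x t] h|[x t] [h0 h] j] /=.
  split=> [|j /=]; first by have := h i; rewrite tnth_mktuple unlift_none.
  by have := h (lift i j); rewrite tnth_mktuple liftK.
rewrite tnth_mktuple; case: unliftP => [l ->|->//]; exact: h.
Qed.

End product_probability.

(** * Fubini and telescoping for product measures *)

Section telescoping.
Context d (X : measurableType d) (R : realType).

Lemma bounded_integrable d' (Y : measurableType d') (Q : probability Y R)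
    (h : Y -> R) : measurable_fun [set: Y] h -> in_linf h ->
  Q.-integrable [set: Y] (EFin \o h).
Proof.
move=> mh bh; apply: measurable_bounded_integrable => //.
exact: fin_num_fun_lty.
Qed.

Section fubini.
Variables (k : nat) (h : k.+1.-tuple X -> R).
Hypotheses (mh : measurable_fun [set: k.+1.-tuple X] h) (bh : in_linf h).

Let mh_insert i : measurable_fun [set: X * k.-tuple X]
  (fun xy => h (insert_coord i xy.1 xy.2)).
Proof. exact: measurableT_comp mh (measurable_insert_pair i). Qed.

Let bh_insert i :
  in_linf (fun xy : X * k.-tuple X => h (insert_coord i xy.1 xy.2)).
Proof.
apply/set_mem/bounded_predP.
by have /bounded_predP[M hM] := mem_set bh; exists M.
Qed.

Lemma partial_intE (Q : probability (k.-tuple X) R) i x :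
  (\int[Q]_y (h (insert_coord i x y))%:E)%E = (partial_int Q h i x)%:E.
Proof.
rewrite /partial_int /Rintegral fineK//; apply: integrable_fin_num => //.
apply: (@bounded_integrable _ _ Q (fun y => h (insert_coord i x y))).
  exact: (measurable_fun_pair2 x (mh_insert i)).
apply/set_mem/bounded_predP.
by have /bounded_predP[M hM] := mem_set bh; exists M.
Qed.

Lemma measurable_partial_int (Q : probability (k.-tuple X) R) i :
  measurable_fun [set: X] (partial_int Q h i).
Proof.
pose nu : probability X R := \d_point.
have mf := measurable_fubini_F
  (bounded_integrable (nu \x Q)%E (@mh_insert i) (@bh_insert i)).
exact: measurableT_comp mf.
Qed.

(** Fubini's theorem, transported along [insert_pair]. *)
Lemma Rintegral_prodm (Q : 'I_k.+1 -> probability X R) i :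
  \int[prodm Q]_t h t =
  \int[Q i]_x partial_int (prodm (Q \o lift i)) h i x.
Proof.
congr fine.
rewrite (eq_measure_integral
  (pushforward (Q i \x prodm (Q \o lift i))%E (insert_pair i))); last first.
  by move=> B mB _; apply/esym; exact: prodm_insert.
have ih := bounded_integrable (Q i \x prodm (Q \o lift i))%E
  (@mh_insert i) (@bh_insert i).
have mh' : measurable_fun setT (EFin \o h) by exact/measurable_EFinP.
rewrite integral_pushforward//.
rewrite preimage_setT -(integral12_prod_meas1 ih).
by apply: eq_integral => x _; rewrite /fubini_F partial_intE.
Qed.

End fubini.

Definition hybrid n (A B : 'I_n -> probability X R) (j : nat) (l : 'I_n) :=
  if (l < j)%N then B l else A l.

Lemma hybrid_lift k (A B : 'I_k.+1 -> probability X R) (i : 'I_k.+1) :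
  hybrid A B i.+1 \o lift i = hybrid A B i \o lift i.
Proof.
apply/funext => l; rewrite /hybrid/= ltnS leq_eqVlt.
by rewrite (_ : (bump i l == i) = false)// eq_sym; exact/negbTE/neq_bump.
Qed.

(** The factors of [A] are replaced by those of [B] from left to right. The
    [i]-th step changes only the law of coordinate [i], so by Fubini it is the
    increment of the integral of a partial integral of [h]. *)
Lemma prodm_telescope k (h : k.+1.-tuple X -> R)
    (A B : 'I_k.+1 -> probability X R) :
    measurable_fun [set: k.+1.-tuple X] h -> in_linf h ->
  \int[prodm A]_t h t - \int[prodm B]_t h t =
  \sum_(i < k.+1)
    (\int[A i]_x partial_int (prodm (hybrid A B i \o lift i)) h i x -
     \int[B i]_x partial_int (prodm (hybrid A B i \o lift i)) h i x).
Proof.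
move=> mh bh; pose a j := - \int[prodm (hybrid A B j)]_t h t.
have -> : \int[prodm A]_t h t = - a 0%N.
  by rewrite opprK; congr Rintegral; congr prodm.
have -> : \int[prodm B]_t h t = - a k.+1.
  rewrite opprK; congr Rintegral; congr prodm.
  by apply/funext => l; rewrite /hybrid ltn_ord.
rewrite opprK addrC -telescope_sumr// big_mkord; apply: eq_bigr => i _.
rewrite /a opprK addrC !(Rintegral_prodm mh bh _ i) hybrid_lift.
by rewrite /hybrid ltnn ltnSn.
Qed.

Definition insert_prob k (i : 'I_k.+1) (nu : probability X R)
    (Q : 'I_k -> probability X R) (j : 'I_k.+1) : probability X R :=
  if unlift i j is Some l then Q l else nu.

(** Freezing a coordinate amounts to giving it a Dirac law, so partial integrals
    are integrals against product measures and can be telescoped too. *)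
Lemma partial_int_dirac k (h : k.+1.-tuple X -> R)
    (Q : 'I_k -> probability X R) i x :
    measurable_fun [set: k.+1.-tuple X] h -> in_linf h ->
  partial_int (prodm Q) h i x =
  \int[prodm (insert_prob i \d_x Q)]_t h t.
Proof.
move=> mh bh; rewrite (Rintegral_prodm mh bh _ i).
rewrite /insert_prob unlift_none.
rewrite (_ : _ \o lift i = Q); last by apply/funext => l /=; rewrite liftK.
rewrite /Rintegral integral_dirac//; first by rewrite diracT mul1e.
by apply/measurable_EFinP; exact: measurable_partial_int.
Qed.

(** Both product measures have the factor [\d_x] at coordinate [i], so that only
    the [k] other steps of the telescoping contribute. *)
Lemma partial_int_close k (h : k.+1.-tuple X -> R)
    (Q Q' : 'I_k -> probability X R) (C : R) i x :
    measurable_fun [set: k.+1.-tuple X] h -> in_linf h ->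
    (forall l (S : 'I_k -> probability X R) j,
      `|\int[Q l]_z partial_int (prodm S) h j z -
        \int[Q' l]_z partial_int (prodm S) h j z| <= C) ->
  `|partial_int (prodm Q) h i x - partial_int (prodm Q') h i x| <= k%:R * C.
Proof.
move=> mh bh QQ'; rewrite !partial_int_dirac// prodm_telescope//.
have insE nu S : insert_prob i nu S i = nu by rewrite /insert_prob unlift_none.
have insliftE nu S l : insert_prob i nu S (lift i l) = S l.
  by rewrite /insert_prob liftK.
rewrite (bigD1_ord i)//= !insE subrr add0r.
rewrite (le_trans (ler_norm_sum _ _ _))//.
rewrite (le_trans (ler_sum _ (G := fun=> C) _))//; last first.
  by rewrite sumr_const card_ord mulr_natl.
by move=> l _; rewrite !insliftE; exact: QQ'.
Qed.

End telescoping.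

(** * The product process as a sum of values of the original one *)

Section decomposition.
Context d (X : measurableType d) (R : realType).

(** Functions of one variable in the class need only be integrable, not bounded;
    hence the separate treatment, by a change of variable. *)
Lemma Rintegral_powm1 (nu : probability X R) (h : 1.-tuple X -> R) :
    measurable_fun [set: X] (fun x => h [tuple x]) ->
    nu.-integrable [set: X] (EFin \o (fun x => h [tuple x])) ->
  \int[powm nu 1]_t h t = \int[nu]_x h [tuple x].
Proof.
move=> mh ih.
pose f (x : X) : 1.-tuple X := [tuple x].
have mf : measurable_fun [set: X] f.
  apply/measurable_fun_tnthP => i; rewrite ord1.
  by apply: (eq_measurable_fun id) => //; exact: measurable_id.
pose f' : {mfun X >-> 1.-tuple X} :=
  HB.pack f (isMeasurableFun.Build _ _ _ _ _ mf).
have mh' : measurable_fun [set: 1.-tuple X] (EFin \o h).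
  apply/measurable_EFinP.
  rewrite (_ : h = (fun x => h [tuple x]) \o (@tnth 1 X ^~ ord0)).
    exact: measurableT_comp mh (measurable_tnth _).
  apply/funext => t /=; congr h; apply: eq_from_tnth => i.
  by rewrite (ord1 i) (tnth_nth (tnth t ord0)).
congr fine; rewrite (eq_measure_integral (pushforward nu f')); last first.
  move=> B mB _; apply/esym.
  apply: (prodm_unique (m := pushforward nu f') (Q := fun=> nu)) => // A mA.
  rewrite big_ord1 /= /pushforward; congr (nu _).
  apply/seteqP; split => [x /(_ ord0)//|x Ax i].
  by rewrite ord1.
by rewrite integral_pushforward.
Qed.

(** The functions [g i] are the partial integrals met when telescoping from the
    powers of [P] to those of [M]: all their integrated coordinates have law [P]
    or [M]. Therefore they are close to the partial integrals with respect to
    [mu], uniformly in the argument and in [h], when [P] and [M] are close to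
    [mu] on [F]. *)
Lemma scaled_diff_decomposition (F : set (X -> R)) k (c : R)
    (P M mu : probability X R)
    (F_measurable : forall f, F f -> measurable_fun [set: X] f)
    (P_int : forall f, F f -> P.-integrable [set: X] (EFin \o f))
    (M_int : forall f, F f -> M.-integrable [set: X] (EFin \o f))
    (h : Fm F k) :
  exists2 g : 'I_k.+1 -> F,
    scaled_diff (Fm F k) c (powm P k.+1) (powm M k.+1) h =
      \sum_(i < k.+1) scaled_diff F c P M (g i) &
    forall C : R,
      (forall f : F, `|integral_on F P f - integral_on F mu f| <= C) ->
      (forall f : F, `|integral_on F M f - integral_on F mu f| <= C) ->
    forall i x, `|val (g i) x - val (hmuF mu h i) x| <= k%:R * C.
Proof.
case: h => h hF /=; have /set_mem := hF; case: k h hF => [|k] h hF.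
  move=> /= Fh; exists (fun=> SigSub (mem_set Fh)) => [|C _ _ i x].
    rewrite big_ord1 /scaled_diff /integral_on/= !Rintegral_powm1//.
    - exact: F_measurable.
    - exact: M_int.
    - exact: F_measurable.
    - exact: P_int.
  by rewrite /= subrr normr0 mul0r.
case=> mh bh Fh.
pose Q (i : 'I_k.+2) : 'I_k.+1 -> probability X R :=
  hybrid (fun=> P) (fun=> M) i \o lift i.
exists (fun i => SigSub (mem_set (Fh (Q i) i))) => [|C PC MC i x /=].
  by rewrite -mulr_sumr; congr (_ * _); exact: prodm_telescope.
apply: partial_int_close => // l S j; rewrite /Q /hybrid/=.
have FS : F (partial_int (prodm S) h j) := Fh S j.
by case: ifP => _; [exact: (MC (SigSub (mem_set FS)))
  |exact: (PC (SigSub (mem_set FS)))].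
Qed.

End decomposition.

(** * Lipschitz envelopes *)

Section lipschitz.
Context (R : realType) (V W : normedModType R).

Lemma lipschitz_bound_continuous (f : V -> W) (C : R) :
  (forall x y, `|f x - f y| <= C * `|x - y|) -> continuous f.
Proof.
move=> fC x; have C1 : 0 < `|C| + 1 by rewrite ltr_wpDl.
apply/cvgrPdist_lt => e e0; near=> y.
apply: (le_lt_trans (fC x y)).
apply: (@le_lt_trans _ _ ((`|C| + 1) * `|x - y|)).
  by rewrite ler_wpM2r// (le_trans (ler_norm _))// lerDl.
rewrite mulrC -ltr_pdivlMr//; near: y.
by apply: cvgr_dist_lt; rewrite ?divr_gt0//; exact: cvg_id.
Unshelve. all: by end_near. Qed.

End lipschitz.

Section envelope.
Context (R : realType) (V : normedModType R) (f : V -> R) (M : R).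
Hypothesis fM : forall x, `|f x| <= M.

(** For [f] bounded and [L >= 0], the least [L]-Lipschitz function above [f]. *)
Definition envelope (L : R) (x : V) : R :=
  sup (range (fun y => f y - L * `|x - y|)).

Let has_sup_envelope (L : R) x : 0 <= L ->
  has_sup (range (fun y => f y - L * `|x - y|)).
Proof.
move=> L0; split; first by exists (f x - L * `|x - x|), x.
exists M => _ [y _ <-]; rewrite lerBlDr (le_trans (ler_norm _))//.
by rewrite (le_trans (fM y))// lerDl mulr_ge0.
Qed.

Lemma envelope_ub L x y : 0 <= L -> f y <= envelope L x + L * `|x - y|.
Proof.
move=> L0; rewrite -lerBlDr; apply: ub_le_sup; last by exists y.
by case: (has_sup_envelope x L0).
Qed.

Lemma envelope_ge L x : 0 <= L -> f x <= envelope L x.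
Proof. by move=> /(envelope_ub x x); rewrite subrr normr0 mulr0 addr0. Qed.

Lemma envelope_le L x (a : R) :
  (forall y, f y - L * `|x - y| <= a) -> envelope L x <= a.
Proof.
move=> fa; apply: ge_sup; first by exists (f x - L * `|x - x|), x.
by move=> _ [y _ <-].
Qed.

Lemma envelope_bounded L x : 0 <= L -> `|envelope L x| <= M.
Proof.
move=> L0; rewrite ler_norml; apply/andP; split.
  rewrite (le_trans _ (envelope_ge x L0))//.
  by have := fM x; rewrite ler_norml => /andP[].
apply: envelope_le => y; rewrite lerBlDr (le_trans (ler_norm _))//.
by rewrite (le_trans (fM y))// lerDl mulr_ge0.
Qed.

Lemma envelope_lipschitz L x y : 0 <= L ->
  `|envelope L x - envelope L y| <= L * `|x - y|.
Proof.
move=> L0.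
have le a b : envelope L a <= envelope L b + L * `|a - b|.
  apply: envelope_le => z; rewrite lerBlDr (le_trans (envelope_ub b z L0))//.
  rewrite -addrA lerD2l -mulrDr ler_wpM2l//.
  by rewrite (distrC a b) ler_distD.
by rewrite ler_distl lerBlDr le andbT distrC le.
Qed.

(** Beyond a fixed distance [del] from [x] the penalty exceeds the oscillation of
    [f] once [n * del >= 2 * M]; within [del], continuity applies. *)
Lemma envelope_cvg x : {for x, continuous (f : V -> R^o)} ->
  envelope n%:R x @[n --> \oo] --> f x.
Proof.
move=> /cvgrPdist_lt cf; apply/cvgrPdist_le => e e0.
have /nbhs_normP[del /= del0 fdel] := cf e e0.
have M0 : 0 <= M := le_trans (normr_ge0 _) (fM x).
near=> n.
have n0 : 0 <= n%:R :> R by [].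
rewrite distrC ger0_norm ?subr_ge0 ?envelope_ge// lerBlDl.
apply: envelope_le => y.
have [xy|xy] := ltP `|x - y| del.
  rewrite lerBlDr (le_trans (_ : _ <= f x + e))//; last first.
    by rewrite lerDl mulr_ge0.
  by have := fdel y xy; rewrite ltr_distlC => /andP[_ /ltW].
rewrite (le_trans (_ : _ <= M - n%:R * del))//.
  by rewrite lerB ?ler_wpM2l// (le_trans (ler_norm _)).
rewrite (le_trans (_ : _ <= - M))//.
  rewrite lerBlDl -lerBlDr opprK -ler_pdivrMr//.
  by near: n; exact: nbhs_infty_ger.
have := fM x; rewrite ler_norml => /andP[h _].
by rewrite (le_trans h)// lerDl ltW.
Unshelve. all: by end_near. Qed.

End envelope.

(** * Borel maps and bounded convergence *)

Section bounded_convergence.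
Context (R : realType) (V : normedModType R).
Context d (W : measurableType d) (P : probability W R) (Y : W -> V).
Hypothesis bY : borel_measurable Y.

Lemma borel_measurable_comp (U : normedModType R) (f : V -> U) :
  continuous f -> borel_measurable (f \o Y).
Proof.
move=> /continuousP cf.
pose g : W -> g_sigma_algebraType (@open U) := f \o Y.
apply: (@measurability _ _ W _ setT g (@open U)) => //.
move=> _ [B oB <-]; rewrite setTI comp_preimage -[X in measurable X]setTI.
by apply: bY => //; apply: sub_sigma_algebra; exact: cf.
Qed.

Lemma measurable_continuous_comp (f : V -> R^o) :
  continuous f -> measurable_fun [set: W] (fun w => f (Y w) : R).
Proof.
move=> /continuousP cf; apply: (measurability _ (RGenOpens.measurableE R)).
move=> _ [_ [a [b ->] <-]].
rewrite -[_ @^-1` _]/(Y @^-1` (f @^-1` `]a, b[%classic)).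
apply: bY => //; apply: sub_sigma_algebra; apply: cf; exact: interval_open.
Qed.

Variable B : R.

Lemma integrable_continuous_comp (f : V -> R^o) :
    continuous f -> (forall x, `|f x| <= B) ->
  P.-integrable [set: W] (fun w => (f (Y w))%:E).
Proof.
move=> cf fB; apply: (@bounded_integrable _ _ _ P (fun w => f (Y w))).
  exact: measurable_continuous_comp.
by apply/set_mem/bounded_predP; exists B => w; exact: fB.
Qed.

Lemma expectation_continuous_comp (f : V -> R^o) :
    continuous f -> (forall x, `|f x| <= B) ->
  ('E_P[fun w => f (Y w)] = (\int[P]_w f (Y w))%:E)%E.
Proof.
move=> cf fB; rewrite unlock /Rintegral fineK//.
by apply: integrable_fin_num => //; exact: integrable_continuous_comp.
Qed.

(** Dominated convergence on the probability space of [Y]. *)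
Lemma cvg_Rintegral_continuous_comp (f_ : nat -> V -> R^o) (f : V -> R^o) :
    (forall j, continuous (f_ j)) -> continuous f ->
    (forall j x, `|f_ j x| <= B) ->
    {ae P, forall w, f_ j (Y w) @[j --> \oo] --> f (Y w)} ->
  \int[P]_w f_ j (Y w) @[j --> \oo] --> (\int[P]_w f (Y w) : R).
Proof.
move=> cf_ cf f_B f_f.
have [|||||if_ _ icvg] := @dominated_convergence _ _ _ P setT measurableT
  (fun j w => (f_ j (Y w))%:E) (fun w => (f (Y w))%:E) (cst B%:E).
- by move=> j; apply/measurable_EFinP; exact: measurable_continuous_comp.
- by apply/measurable_EFinP; exact: measurable_continuous_comp.
- apply: filterS f_f => w fw _; apply: cvg_EFin; last exact: fw.
  by near=> n.
- exact: finite_measure_integrable_cst.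
- by apply: aeW => w n _; rewrite abse_EFin lee_fin.
apply: fine_cvg; rewrite fineK//; last exact: integrable_fin_num.
Unshelve. all: by end_near. Qed.

End bounded_convergence.

(** * Stability of weak convergence under small perturbations *)

Section continuity.
Context (R : realType) (T : topologicalType).

Lemma continuous_addM (f g : T -> R^o) (c : R) :
  continuous f -> continuous g -> continuous (fun z => f z + c * g z : R^o).
Proof.
move=> cf cg z; apply: cvgD; first exact: cf.
by apply: (@cvgM R); [exact: cvg_cst|exact: cg].
Qed.

Lemma continuous_opp (f : T -> R^o) :
  continuous f -> continuous (fun z => - f z : R^o).
Proof. by move=> cf z; apply: cvgN; exact: cf. Qed.

End continuity.

Section weak_convergence.
Context (R : realType).

Lemma le_outer_expectation d (W : measurableType d) (P : probability W R)
    (Z Z' : W -> \bar R) : (forall w, (Z w <= Z' w)%E) ->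
  (outer_expectation P Z <= outer_expectation P Z')%E.
Proof.
move=> ZZ'; apply: ereal_inf_le_tmp => _ [U [mU iU Z'U] <-]; exists U => //.
by split=> // w; exact: le_trans (ZZ' w) (Z'U w).
Qed.

Lemma cvgeP_fin (u : nat -> \bar R) (l : R) :
  u n @[n --> \oo] --> l%:E <->
  forall e, 0 < e ->
    \forall n \near \oo, ((l - e)%:E <= u n <= (l + e)%:E)%E.
Proof.
split=> [/fine_cvgP[ufin /cvgrPdist_le ul] e e0|ul].
  near=> n.
  have un : u n \is a fin_num by near: n.
  by rewrite -(fineK un) !lee_fin -ler_distlC; near: n; exact: ul.
apply/fine_cvgP; split.
  near=> n; rewrite fin_numElt.
  have /andP[h1 h2] : ((l - 1)%:E <= u n <= (l + 1)%:E)%E.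
    by near: n; exact: ul.
  by rewrite (lt_le_trans _ h1) ?ltNyr// (le_lt_trans h2) ?ltry.
apply/cvgrPdist_le => e e0; near=> n.
have : ((l - e)%:E <= u n <= (l + e)%:E)%E by near: n; exact: ul.
by rewrite ler_distlC /=; case: (u n) => [x||]; rewrite ?lee_fin ?leeye_eq ?leeNy_eq ?andbF.
Unshelve. all: by end_near. Qed.

Context (T S : Type) (dn : nat -> measure_display)
  (Wn : forall n, measurableType (dn n)) (Pn : forall n, probability (Wn n) R)
  (Xn : forall n, Wn n -> linf R T) (Yn : forall n, Wn n -> linf R S)
  d (W : measurableType d) (P : probability W R) (X : W -> linf R T)
  (A : linf R T -> linf R S) (rho : nat -> linf R T -> R^o).
Hypotheses (XnX : weak_cvg Pn Xn P X) (cA : continuous A)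
  (crho : forall j, continuous (rho j))
  (rho01 : forall j z, 0 <= rho j z <= 1)
  (rho0 : {ae P, forall w, rho j (X w) @[j --> \oo] --> (0 : R)})
  (rhoP : forall j, \forall n \near \oo,
    forall w : Wn n, Num.min 1 `|Yn w - A (Xn w)| <= rho j (Xn w)).

Let bX : borel_measurable X := XnX.1.

(* [g] is an envelope of [f] at [A z] plus a multiple of [rho j z]: the envelope
   absorbs the fact that [f] is not Lipschitz, the multiple of [rho j] the
   distance from [Yn] to [A (Xn)]. First [L], then [j], is taken large. *)
Let upper_test (f : linf R S -> R^o) (M : R) (e : R) :
    continuous f -> (forall y, `|f y| <= M) -> 0 < e ->
  exists g : linf R T -> R^o, [/\ continuous g,
    exists B, forall z, `|g z| <= B,
    \forall n \near \oo, forall w : Wn n, f (Yn w) <= g (Xn w) &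
    \int[P]_w g (X w) <= \int[P]_w f (A (X w)) + e].
Proof.
move=> cf fM e0.
have M0 : 0 <= M := le_trans (normr_ge0 _) (fM 0).
have cenv (L : R) : 0 <= L -> continuous (envelope f L \o A : _ -> R^o).
  move=> L0 z; apply: continuous_comp; first exact: cA.
  apply: (@lipschitz_bound_continuous _ _ R^o (envelope f L) L) => x y.
  exact: envelope_lipschitz fM _ _ _ L0.
have e20 : 0 < e / 2 by rewrite divr_gt0.
have [L ?] : exists L : nat, \int[P]_w envelope f L%:R (A (X w)) <=
    \int[P]_w f (A (X w)) + e / 2.
  have : \int[P]_w envelope f n%:R (A (X w)) @[n --> \oo] -->
      (\int[P]_w f (A (X w)) : R).
    apply: (cvg_Rintegral_continuous_comp bX (B := M)
      (f_ := fun n => envelope f n%:R \o A) (f := f \o A)).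
    - by move=> n; exact: cenv.
    - by move=> z; apply: continuous_comp; [exact: cA|exact: cf].
    - by move=> n z; exact: envelope_bounded.
    - by apply: aeW => w; apply: (envelope_cvg fM); exact: cf.
  move/cvgrPdist_le => /(_ _ e20)[n _ /(_ n (leqnn n))].
  by rewrite /= ler_distlC => /andP[_ ?]; exists n.
have L0 : 0 <= L%:R :> R by [].
(* a difference of at most both 2 M and L * t is at most C * min 1 t *)
pose C := M + M + L%:R.
have C0 : 0 <= C by rewrite !addr_ge0.
pose g j z : R^o := envelope f L%:R (A z) + C * rho j z.
have cg j : continuous (g j).
  by apply: continuous_addM; [exact: cenv|exact: crho].
have gB j z : `|g j z| <= M + C.
  rewrite (le_trans (ler_normD _ _))// lerD ?envelope_bounded//.
  have /andP[r0 r1] := rho01 j z.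
  by rewrite normrM !ger0_norm// ler_piMr.
have [j ?] : exists j : nat, \int[P]_w g j (X w) <=
    \int[P]_w envelope f L%:R (A (X w)) + e / 2.
  have : \int[P]_w g n (X w) @[n --> \oo] -->
      (\int[P]_w envelope f L%:R (A (X w)) : R).
    apply: (cvg_Rintegral_continuous_comp bX (B := M + C)
      (f := envelope f L%:R \o A)) => //; first exact: cenv.
    apply: filterS rho0 => w rw.
    rewrite -[X in _ --> X]addr0 -[X in _ --> _ + X](mulr0 C).
    apply: (@cvgD _ R^o); first exact: cvg_cst.
    by apply: (@cvgM R); [exact: cvg_cst|exact: rw].
  move/cvgrPdist_le => /(_ _ e20)[n _ /(_ n (leqnn n))].
  by rewrite /= ler_distlC => /andP[_ ?]; exists n.
exists (g j); split=> //; first by exists (M + C).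
- have := rhoP j; apply: filterS => n h w; have {h} := h w.
  set y := Yn w; set z := A _ => yz.
  rewrite /g; apply: (@le_trans _ _ (envelope f L%:R z + C * Num.min 1 `|y - z|)).
    rewrite minElt; case: ifPn => [_|_].
      rewrite mulr1 /C.
      have := envelope_bounded fM z L0; rewrite ler_norml => /andP[h _].
      have := fM y; rewrite ler_norml => /andP[_ h'].
      by lra.
    rewrite (le_trans (envelope_ub fM z y L0))// lerD2l distrC ler_wpM2r//.
    by rewrite /C lerDr addr_ge0.
  by rewrite lerD2l ler_wpM2l.
- by lra.
Qed.

(** A Slutsky-type lemma. The functions [rho j] are evaluated at [Xn], so that
    [f (Yn w)] is compared pointwise with one bounded continuous function of
    [Xn w]; monotonicity of the outer expectation and the weak convergence of
    [Xn] do the rest. *)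
Lemma weak_cvg_approx : weak_cvg Pn Yn P (A \o X).
Proof.
split; first exact: borel_measurable_comp.
move=> f cf bf.
have /bounded_predP[M fM] := mem_set bf.
have cfA : continuous (f \o A : _ -> R^o).
  by move=> z; apply: continuous_comp; [exact: cA|exact: cf].
rewrite (expectation_continuous_comp P bX cfA (fun z => fM (A z))).
have Xcvg (g : linf R T -> R^o) B : continuous g -> (forall z, `|g z| <= B) ->
    outer_expectation (Pn n) (fun w : Wn n => (g (Xn w))%:E) @[n --> \oo] -->
    (\int[P]_w g (X w))%:E.
  move=> cg gB; rewrite -(expectation_continuous_comp P bX (B := B))//.
  by apply: XnX.2 => //; apply/set_mem/bounded_predP; exists B.
apply/cvgeP_fin => e e0; have e20 : 0 < e / 2 by rewrite divr_gt0.
have [g [cg [B gB] fg gf]] := upper_test cf fM e20.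
(* the lower bound is the upper bound for - f *)
have cNf : continuous (fun y => - f y : R^o).
  exact: continuous_opp.
have [|g' [cg' [B' gB'] fg' gf']] := upper_test cNf (M := M) _ e20.
  by move=> y; rewrite normrN.
have cNg' : continuous (fun z => - g' z : R^o).
  exact: continuous_opp.
have ub : \forall n \near \oo,
    (outer_expectation (Pn n) (fun w : Wn n => (g (Xn w))%:E) <=
     (\int[P]_w g (X w) + e / 2)%:E)%E.
  have := (cvgeP_fin _ _).1 (Xcvg g B cg gB) _ e20.
  by apply: filterS => n /andP[].
have gN'B z : `|- g' z| <= B' by rewrite normrN.
have lb : \forall n \near \oo,
    ((\int[P]_w - g' (X w) - e / 2)%:E <=
     outer_expectation (Pn n) (fun w : Wn n => (- g' (Xn w))%:E))%E.
  have := (cvgeP_fin _ _).1 (Xcvg _ B' cNg' gN'B) _ e20.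
  by apply: filterS => n /andP[].
have Ng' : \int[P]_w - g' (X w) = - \int[P]_w g' (X w).
  rewrite -[RHS]mulN1r -RintegralZl//.
    by apply: eq_Rintegral => w _; rewrite mulN1r.
  exact: (integrable_continuous_comp P bX cg' gB').
have Nf : \int[P]_w - f (A (X w)) = - \int[P]_w f (A (X w)).
  rewrite -[RHS]mulN1r -RintegralZl//.
    by apply: eq_Rintegral => w _; rewrite mulN1r.
  exact: (integrable_continuous_comp P bX cfA (fun z => fM (A z))).
rewrite Nf in gf'.
near=> n; apply/andP; split.
- apply: (@le_trans _ _ (\int[P]_w - g' (X w) - e / 2)%:E).
    by rewrite lee_fin Ng'; lra.
  apply: (@le_trans _ _
    (outer_expectation (Pn n) (fun w : Wn n => (- g' (Xn w))%:E))).
    by near: n.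
  apply: le_outer_expectation => w; rewrite lee_fin lerNl; move: w.
  by near: n.
- apply: (@le_trans _ _ (\int[P]_w g (X w) + e / 2)%:E); last first.
    by rewrite lee_fin; lra.
  apply: (@le_trans _ _
    (outer_expectation (Pn n) (fun w : Wn n => (g (Xn w))%:E))); last first.
    by near: n.
  by apply: le_outer_expectation => w; rewrite lee_fin; move: w; near: n.
Unshelve. all: by end_near. Qed.

End weak_convergence.

(** * Oscillation of a process over uniformly close functions *)

Lemma continuous_min1_max0 (R : realType) (T : topologicalType)
    (f g : T -> R^o) (c : R) : continuous f -> continuous g ->
  continuous (fun z => Num.min 1 (Num.max 0 (f z) + c * g z) : R^o).
Proof.
move=> cf cg.
have cm : continuous (cst (0 : R^o) \max f).
  by move=> z; apply: continuous_max; [exact: cvg_cst|exact: cf].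
have cs := continuous_addM (c := c) cm cg.
move=> z; apply: (@continuous_min _ _ (cst (1 : R^o)) _ _ _ (cs z)).
exact: cvg_cst.
Qed.

Section oscillation.
Context d (X : measurableType d) (R : realType) (F : set (X -> R)).

Lemma osc_subproof (delta : R) (z : linf R F) :
  in_linf (fun p : F * F =>
    if (sup_norm (val p.1 \- val p.2)%R < delta%:E)%E then z p.1 - z p.2 else 0).
Proof.
apply/set_mem/bounded_predP; exists (`|z| + `|z|) => p.
case: ifP => _; last by rewrite normr0 addr_ge0.
by rewrite (le_trans (ler_normB _ _))// lerD// linf_norm_ub.
Qed.

(** The modulus of continuity is represented by the norm of a difference operator
    with values in l^oo of the pairs: its continuity in [z] is then that of a
    bounded linear map, and an empty [F] is not exceptional. *)
Definition osc (delta : R) (z : linf R F) : linf R (F * F)%type :=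
  Linf (osc_subproof delta z).

Lemma osc_ub delta (z : linf R F) (f g : F) :
    (sup_norm (val f \- val g)%R < delta%:E)%E ->
  `|z f - z g| <= `|osc delta z|.
Proof. by move=> fg; have := linf_norm_ub (osc delta z) (f, g); rewrite /= fg. Qed.

Lemma osc_continuous delta : continuous (osc delta).
Proof.
apply: (@lipschitz_bound_continuous _ _ _ _ 2) => x y.
apply: linf_norm_le => [|p]; first by rewrite mulr_ge0.
rewrite -[linf_fun _ _]/(osc delta x p - osc delta y p) /=.
case: ifP => _; last by rewrite subrr normr0 mulr_ge0.
have -> : x p.1 - x p.2 - (y p.1 - y p.2) = (x - y) p.1 - (x - y) p.2.
  by rewrite !opprD !opprK [LHS]addrACA.
rewrite (le_trans (ler_normB _ _))// mulr2n mulrDl mul1r.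
by rewrite lerD// linf_norm_ub.
Qed.

Variable K : R.
Hypothesis K0 : 0 < K.

(** The first summand forces the value 1 once [`|z| >= j + 1], so that an estimate
    valid for [`|z| < j + 1] suffices to dominate truncated errors. *)
Definition osc_test (j : nat) (z : linf R F) : R^o :=
  Num.min 1 (Num.max 0 (`|z| - j%:R) + K * `|osc j.+1%:R^-1 z|).

Lemma osc_test_continuous j : continuous (osc_test j).
Proof.
pose f (z : linf R F) : R^o := `|z| - j%:R.
pose g (z : linf R F) : R^o := `|osc j.+1%:R^-1 z|.
have cf : continuous f.
  apply: (@lipschitz_bound_continuous _ _ R^o f 1) => x y.
  by rewrite mul1r /f opprB addrA subrK ler_dist_dist.
have cg : continuous g.
  by move=> z; apply: continuous_comp; [exact: osc_continuous|exact: norm_continuous].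
exact: (continuous_min1_max0 (c := K) cf cg).
Qed.

Lemma osc_test_ge0_le1 j z : 0 <= osc_test j z <= 1.
Proof.
rewrite /osc_test le_min ler01/= addr_ge0 ?le_max ?lexx//=.
  by rewrite ge_min lexx.
by rewrite mulr_ge0// ltW.
Qed.

Lemma osc_test_cvg (z : linf R F) : sup_unif_continuous z ->
  osc_test j z @[j --> \oo] --> (0 : R).
Proof.
move=> zu; apply/cvgrPdist_le => e e0.
have [del del0 zdel] := zu (e / K) (divr_gt0 e0 K0).
near=> j.
rewrite sub0r normrN ger0_norm; last by have /andP[] := osc_test_ge0_le1 j z.
rewrite /osc_test max_l; last first.
  by rewrite subr_le0; near: j; exact: nbhs_infty_ger.
rewrite add0r ge_min; apply/orP; right.
rewrite mulrC -ler_pdivlMr//.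
apply: linf_norm_le => [|p /=]; first by rewrite ltW// divr_gt0.
case: ifPn => [pj|_]; last by rewrite normr0 ltW// divr_gt0.
apply/ltW/zdel; apply: (lt_le_trans pj); rewrite lee_fin.
by apply/ltW; near: j; exact: (near_infty_natSinv_lt (PosNum del0)).
Unshelve. all: by end_near. Qed.

End oscillation.

(** * Transfer of properties of the limit process *)

Section transfer.
Context (R : realType) d (W : measurableType d) (P : probability W R).

Lemma tight_continuous_comp (V U : normedModType R) (Y : W -> V) (A : V -> U) :
  continuous A -> tight P Y -> tight P (A \o Y).
Proof.
move=> cA tY e /tY[K cK [B [mB BK PB]]]; exists (A @` K).
  by apply: continuous_compact => //; exact: continuous_subspaceT.
by exists B; split=> // w /BK Kw; exists (Y w).
Qed.

Lemma Lfun2_sum (n : nat) (Y : 'I_n -> W -> R) :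
    (forall i, Y i \in Lfun P 2%:E) ->
  (fun w => \sum_(i < n) Y i w) \in Lfun P 2%:E.
Proof.
move=> Y2; rewrite (_ : (fun w => _) = \sum_(i < n) Y i); last first.
  by apply/funext => w; rewrite fct_sumE.
by rewrite rpred_sum ?lee1n//= => _ i _; exact: Y2.
Qed.

Lemma covariance_suml (n : nat) (Y : 'I_n -> W -> R) (Z : W -> R) :
    (forall i, Y i \in Lfun P 2%:E) -> Z \in Lfun P 2%:E ->
  (covariance P (fun w => \sum_(i < n) Y i w)%R Z =
   \sum_(i < n) covariance P (Y i) Z)%E.
Proof.
elim: n Y => [|n IH] Y Y2 Z2.
  rewrite big_ord0 (_ : (fun w => _) = cst 0) ?covariance_cst_l//.
  by apply/funext => w; rewrite big_ord0.
rewrite big_ord_recl -IH//.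
rewrite -covarianceDl//; last by apply: Lfun2_sum => i; exact: Y2.
by congr (covariance P _ Z); apply/funext => w; rewrite big_ord_recl.
Qed.

End transfer.

Section G_mu_operator.
Context d (X : measurableType d) (R : realType) (F : set (X -> R)).
Variables (mu : probability X R) (k : nat).

Lemma G_mu_linear : linear (G_mu mu k : linf R F -> linf R (Fm F k)).
Proof.
move=> a u v; apply: linfP => h.
rewrite -[RHS]/(a * \sum_(i < k.+1) u (hmuF mu h i) +
  \sum_(i < k.+1) v (hmuF mu h i)).
by rewrite mulr_sumr -big_split.
Qed.

Lemma G_mu_continuous : continuous (G_mu mu k : linf R F -> linf R (Fm F k)).
Proof.
apply: (@lipschitz_bound_continuous _ _ _ _ k.+1%:R) => u v.
apply: linf_norm_le => [|h]; first by rewrite mulr_ge0.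
rewrite -[linf_fun _ _]/(\sum_(i < k.+1) u (hmuF mu h i) -
  \sum_(i < k.+1) v (hmuF mu h i)) -sumrB.
rewrite (le_trans (ler_norm_sum _ _ _))//.
rewrite (le_trans (ler_sum _ (G := fun=> `|u - v|) _))//; last first.
  by rewrite sumr_const card_ord mulr_natl.
by move=> i _; exact: (linf_norm_ub (u - v)).
Qed.

Context d' (W : measurableType d') (P : probability W R) (G : W -> linf R F).

(** A linear combination of coordinates of the image is one of coordinates of
    [G], indexed by the pairs of an old index and a coordinate of the tuple. *)
Lemma G_mu_gaussian : gaussian P G -> gaussian P (fun w => G_mu mu k (G w)).
Proof.
move=> gG n t a.
pose I : finType := ('I_n * 'I_k.+1)%type.
have := gG #|I| (fun p => hmuF mu (t (enum_val p).1) (enum_val p).2)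
  (fun p => a (enum_val p).1).
rewrite (_ : (fun w => _) = (fun w => \sum_(i < n) a i * G_mu mu k (G w) (t i)))//.
apply/funext => w.
rewrite -(big_enum_val (A := {: I}) (fun p : I => a p.1 * G w (hmuF mu (t p.1) p.2))).
rewrite -(pair_bigA _ (fun i (j : 'I_k.+1) => a i * G w (hmuF mu (t i) j))).
by apply: eq_bigr => i _; rewrite -mulr_sumr.
Qed.

Lemma G_mu_centred : centred P G -> centred P (fun w => G_mu mu k (G w)).
Proof.
move=> cG h.
have E : (fun w => (G_mu mu k (G w) h)%:E) =
    (fun w => \sum_(i < k.+1) (G w (hmuF mu h i))%:E)%E.
  by apply/funext => w; rewrite -sumEFin.
split; first by rewrite E; apply: integrable_sum => // i; case: (cG (hmuF mu h i)).
rewrite unlock E integral_sum//; last by move=> i; case: (cG (hmuF mu h i)).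
rewrite big1// => i _; have [_] := cG (hmuF mu h i); by rewrite unlock.
Qed.

Lemma G_mu_covariance (Gamma : F -> F -> R) : has_covariance P G Gamma ->
  has_covariance P (fun w => G_mu mu k (G w)) (Gamma_mu mu Gamma).
Proof.
move=> [G2 GG]; split=> [h|h h'].
  by apply: (Lfun2_sum (Y := fun i w => G w (hmuF mu h i))) => i; exact: G2.
have S2 (f : Fm F k) : (fun w => G_mu mu k (G w) f : R) \in Lfun P 2%:E.
  by apply: (Lfun2_sum (Y := fun i w => G w (hmuF mu f i))) => i; exact: G2.
rewrite (covariance_suml (Y := fun i w => G w (hmuF mu h i)))//.
rewrite /Gamma_mu -sumEFin; apply: eq_bigr => i _.
rewrite covarianceC (covariance_suml (Y := fun i w => G w (hmuF mu h' i)))//.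
by rewrite -sumEFin; apply: eq_bigr => j _; rewrite covarianceC GG.
Qed.

End G_mu_operator.

(** * Weak convergence of the product process *)

(* m = k + 1 ranges over the positive integers. *)
Theorem theorem3p4 (R : realType) (d : measure_display) (X : measurableType d)
    (F : set (X -> R))
    (dW : nat -> measure_display) (W : forall n, measurableType (dW n))
    (Pr : forall n, probability (W n) R)
    (P : forall n, W n -> probability X R)
    (mu_ : nat -> probability X R) (mu : probability X R)
    (r : nat -> R)
    (dG : measure_display) (WG : measurableType dG) (PrG : probability WG R)
    (G : WG -> linf R F)
    (F_measurable : forall f, F f -> measurable_fun [set: X] f)
    (P_int : forall n w f, F f -> (P n w).-integrable [set: X] (EFin \o f))
    (mu_n_int : forall n f, F f -> (mu_ n).-integrable [set: X] (EFin \o f))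
    (mu_int : forall f, F f -> mu.-integrable [set: X] (EFin \o f))
    (r_incr : nondecreasing_seq r)
    (r_infty : r n @[n --> \oo] --> +oo)
    (P_linf : forall n w, in_linf (scaled_diff F (r n) (P n w) (mu_ n)))
    (P_cvg : weak_cvg Pr (fun n w => Linf (P_linf n w)) PrG G)
    (mu_n_linf : forall n, in_linf (integral_on F (mu_ n)))
    (mu_linf : in_linf (integral_on F mu))
    (mu_cvg : Linf (mu_n_linf n) @[n --> \oo] --> Linf mu_linf)
    (G_tight : tight PrG G)
    (G_unif : {ae PrG, forall w, sup_unif_continuous (G w)}) :
  forall k : nat,
  [/\ exists Pm_linf : forall n w, in_linf
        (scaled_diff (Fm F k) (r n) (powm (P n w) k.+1) (powm (mu_ n) k.+1)),
      weak_cvg Pr (fun n w => Linf (Pm_linf n w))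
        PrG (fun w => G_mu mu k (G w)),
      linear (G_mu mu k : linf R F -> linf R (Fm F k)),
      continuous (G_mu mu k : linf R F -> linf R (Fm F k)) &
      forall (d' : measure_display) (W' : measurableType d')
        (Pr' : probability W' R) (G' : W' -> linf R F),
      [/\ borel_measurable G' ->
            borel_measurable (fun w => G_mu mu k (G' w)),
          tight Pr' G' -> tight Pr' (fun w => G_mu mu k (G' w)),
          gaussian Pr' G' -> gaussian Pr' (fun w => G_mu mu k (G' w)),
          centred Pr' G' -> centred Pr' (fun w => G_mu mu k (G' w)) &
          forall Gamma : F -> F -> R, has_covariance Pr' G' Gamma ->
            has_covariance Pr' (fun w => G_mu mu k (G' w))
              (Gamma_mu mu Gamma)]].
Proof.
move=> k.
have K0 : (0 : R) < k.+1%:R by rewrite ltr0n.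
pose Gn n w := Linf (P_linf n w).
have decomp n w := @scaled_diff_decomposition d X R F k (r n) (P n w) (mu_ n) mu
  F_measurable (P_int n w) (@mu_n_int n).
have Pm_linf n w : in_linf
    (scaled_diff (Fm F k) (r n) (powm (P n w) k.+1) (powm (mu_ n) k.+1)).
  apply/set_mem/bounded_predP; exists (\sum_(i < k.+1) `|Gn n w|) => h.
  have [g -> _] := decomp n w h.
  rewrite (le_trans (ler_norm_sum _ _ _))// ler_sum// => i _.
  exact: (linf_norm_ub (Gn n w)).
split.
- exists Pm_linf.
  apply: (weak_cvg_approx (rho := osc_test k.+1%:R) P_cvg) => //.
  + exact: G_mu_continuous.
  + by move=> j; exact: osc_test_continuous.
  + by move=> j z; exact: osc_test_ge0_le1.
  + by apply: filterS G_unif => w; exact: osc_test_cvg.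
  move=> j; pose delta : R := j.+1%:R^-1.
  have delta0 : 0 < delta by rewrite invr_gt0.
  pose eta : R := delta / (k.+1%:R * 2).
  have eta0 : 0 < eta by rewrite divr_gt0// mulr_gt0.
  have keta : k%:R * (eta + eta) < delta.
    have -> : delta = k.+1%:R * (eta + eta).
      by rewrite /eta invfM mulrA -splitr mulrC divfK ?gt_eqF.
    by rewrite ltr_pM2r ?addr_gt0// ltr_nat.
  (* j.+1 / r n bounds |P_n - mu_n| when |X_n| < j.+1; each of the k integrated
     coordinates then contributes at most eta + eta to |g i - h_(mu, i)| *)
  near=> n => w.
  have rn : j.+1%:R / eta <= r n.
    by near: n; move/cvgryPge : r_infty; exact.
  have mun : `|Linf (mu_n_linf n) - Linf mu_linf| <= eta.
    by near: n; move/cvgrPdistC_le : mu_cvg; exact.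
  have rn0 : 0 < r n by rewrite (lt_le_trans _ rn)// divr_gt0.
  rewrite -/(Gn n w) /osc_test.
  (* if |X_n| >= j.+1 the test function is 1 and there is nothing to estimate *)
  have [Gj|Gj] := lerP j.+1%:R `|Gn n w|.
    rewrite (le_trans (_ : _ <= 1)) ?ge_min ?lexx//.
    rewrite le_min lexx/= -[leLHS]addr0 lerD ?mulr_ge0//.
    by rewrite le_max lerBrDr -natr1 in Gj *; rewrite addrC Gj orbT.
  rewrite le_min ge_min lexx/= ge_min; apply/orP; right.
  rewrite -[leLHS]add0r lerD ?le_max ?lexx//.
  apply: linf_norm_le => [|h]; first by rewrite mulr_ge0.
  rewrite -[linf_fun _ _]/(scaled_diff (Fm F k) (r n) (powm (P n w) k.+1)
    (powm (mu_ n) k.+1) h - \sum_(i < k.+1) Gn n w (hmuF mu h i)).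
  have [g -> gC] := decomp n w h.
  rewrite -sumrB (le_trans (ler_norm_sum _ _ _))//.
  rewrite (le_trans (ler_sum _ (G := fun=> `|osc delta (Gn n w)|) _))//; last first.
    by rewrite sumr_const card_ord mulr_natl.
  move=> i _; apply: (@osc_ub _ _ _ _ delta (Gn n w)).
  have munf f : `|integral_on F (mu_ n) f - integral_on F mu f| <= eta.
    exact: le_trans (linf_norm_ub (Linf (mu_n_linf n) - Linf mu_linf) f) mun.
  apply: (@le_lt_trans _ _ (k%:R * (eta + eta))%:E); last by rewrite lte_fin.
  apply: ge_ereal_sup => _ [x _ <-]; rewrite lee_fin.
  apply: gC => f; last by rewrite (le_trans (munf f))// lerDl ltW.
  rewrite (le_trans (ler_distD (integral_on F (mu_ n) f) _ _))// lerD//.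
  rewrite -(ler_pM2l rn0) -[X in X * `|_|](gtr0_norm rn0) -normrM.
  rewrite (le_trans (linf_norm_ub (Gn n w) f))// (le_trans (ltW Gj))//.
  by rewrite -ler_pdivrMr.
- exact: G_mu_linear.
- exact: G_mu_continuous.
- move=> d' W' Pr' G'; split.
  + by move=> /borel_measurable_comp; apply; exact: G_mu_continuous.
  + by apply: tight_continuous_comp; exact: G_mu_continuous.
  + exact: G_mu_gaussian.
  + exact: G_mu_centred.
  + by move=> Gamma; exact: G_mu_covariance.
Unshelve. all: by end_near. Qed.
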